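(* For every $B=[D;A]$, every integer $k\ge1$, every $R>0$ and every $\varepsilon\ge0$, $$\frac12\min\Bigl\{R,\frac{2\varepsilon}{\gamma_k(D,A)}\Bigr\}\ \le\ \mathfrak R_k(B;R,\varepsilon)\ \le\ \min\Bigl\{R,\frac{2\varepsilon}{\gamma_k(D,A)}\Bigr\},$$ with the convention that $2\varepsilon/\gamma_k(D,A)=+\infty$ when $\gamma_k(D,A)=0$. In particular, if $\gamma_k(D,A)=0$ and amplitudes are unbounded (i.e. the norm constraint $\|e\|_2\le R$ is dropped), then the worst-case risk of every estimator is $+\infty$.
   Context: Let $G=(V,E)$ be a finite directed multigraph with $V=\{1,\dots,n\}$. Each node $i$ carries a finite-dimensional real Hilbert space $\mathcal H_i$; $\mathcal H=\bigoplus_{i=1}^n\mathcal H_i$ (with $\mathcal H\neq\{0\}$), with norm $\|h\|_2^2=\sum_i\|h_i\|^2$. The group sparsity of $h\in\mathcal H$ is $\|h\|_{0,\mathrm g}=|\{i\in V:h_i\ne0\}|$. Each edge $e=(i,j)$ carries a weight $w_e>0$ and a linear map $T_e:\mathcal H_i\to\mathcal H_j$, and $D$ is the linear operator $(Dz)_e=\sqrt{w_e}(z_j-T_ez_i)$, $e=(i,j)\in E$. $A:\mathcal H\to\mathcal K$ is a linear map into a finite-dimensional real Hilbert space. $B=[D;A]:\mathcal H\to\mathcal Y$ is the stacked operator $Bh=(Dh,\,Ah)$, so $\|Bh\|_2^2=\|Dh\|_2^2+\|Ah\|_2^2$. The margin is $$\gamma_k(D,A)=\min_{h\ne0,\ \|h\|_{0,\mathrm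 g}\le2k}\frac{\|Bh\|_2}{\|h\|_2}.$$ Let $\mathcal E_k(R)=\{e\in\mathcal H:\|e\|_{0,\mathrm g}\le k,\ \|e\|_2\le R\}$. The minimax risk under deterministic noise of radius $\varepsilon$ is $$\mathfrak R_k(B;R,\varepsilon)=\inf_{\widehat e}\ \sup_{e\in\mathcal E_k(R),\ \xi\in\mathcal Y,\ \|\xi\|_2\le\varepsilon}\|\widehat e(Be+\xi)-e\|_2,$$ where the infimum is over all estimators, i.e. functions $\widehat e:\mathcal Y\to\mathcal H$, deterministic or randomized (for a randomized estimator the loss is replaced by its expectation over the internal randomization). *)

(* Defs.v *)
From HB Require Import structures.
From mathcomp Require Import all_boot all_order all_algebra.
From mathcomp Require Import all_classical all_reals all_analysis.

Set Implicit Arguments.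
Unset Strict Implicit.
Unset Printing Implicit Defensive.

Import Order.TTheory GRing.Theory Num.Theory.
Local Open Scope classical_set_scope.
Local Open Scope ring_scope.

(* MathComp puts a module structure on [{ffun I -> V}] only for a constant V;
   [dsum H] is the direct sum of a dependent family. *)
Definition dsum (R : realType) (I : finType) (H : I -> vectType R) : Type :=
  {dffun forall i : I, H i}.

Section DirectSum.
Context (R : realType) (I : finType) (H : I -> vectType R).
Implicit Types f g h : dsum H.

HB.instance Definition _ := Choice.on (dsum H).

Definition dsum_zero : dsum H := [ffun i => 0].
Definition dsum_opp f : dsum H := [ffun i => - f i].
Definition dsum_add f g : dsum H := [ffun i => f i + g i].
Definition dsum_scale (a : R) f : dsum H := [ffun i => a *: f i].

Fact dsum_addA : associative dsum_add.
Proof. by move=> f g h; apply/ffunP => i; rewrite !ffunE addrA. Qed.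
Fact dsum_addC : commutative dsum_add.
Proof. by move=> f g; apply/ffunP => i; rewrite !ffunE addrC. Qed.
Fact dsum_add0 : left_id dsum_zero dsum_add.
Proof. by move=> f; apply/ffunP => i; rewrite !ffunE add0r. Qed.
Fact dsum_addN : left_inverse dsum_zero dsum_opp dsum_add.
Proof. by move=> f; apply/ffunP => i; rewrite !ffunE addNr. Qed.

HB.instance Definition _ :=
  GRing.isZmodule.Build (dsum H) dsum_addA dsum_addC dsum_add0 dsum_addN.

Fact dsum_scaleA a b f :
  dsum_scale a (dsum_scale b f) = dsum_scale (a * b) f.
Proof. by apply/ffunP => i; rewrite !ffunE scalerA. Qed.
Fact dsum_scale1 : left_id 1 dsum_scale.
Proof. by move=> f; apply/ffunP => i; rewrite !ffunE scale1r. Qed.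
Fact dsum_scaleDr : right_distributive dsum_scale +%R.
Proof. by move=> a f g; apply/ffunP => i; rewrite !ffunE scalerDr. Qed.
Fact dsum_scaleDl f : {morph dsum_scale^~ f : a b / a + b}.
Proof. by move=> a b; apply/ffunP => i; rewrite !ffunE scalerDl. Qed.

HB.instance Definition _ := GRing.Zmodule_isLmodule.Build R (dsum H)
  dsum_scaleA dsum_scale1 dsum_scaleDr dsum_scaleDl.

End DirectSum.

Section Norms.
Context (R : realType).

Definition dot_norm (V : vectType R) (dotV : {dot V for idfun}) (v : V) : R :=
  Num.sqrt (dotV v v).

Definition dsum_norm (I : finType) (H : I -> vectType R)
    (dotH : forall i, {dot H i for idfun}) (h : dsum H) : R :=
  Num.sqrt (\sum_i dot_norm (dotH i) (h i) ^+ 2).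

Definition group_sparsity (I : finType) (H : I -> vectType R) (h : dsum H)
  : nat := #|[set i | h i != 0]%SET|.

End Norms.

Section Observation.
Context (R : realType) (n : nat) (E : finType) (src tgt : E -> 'I_n).
Context (H : 'I_n -> vectType R) (dotH : forall i, {dot H i for idfun}).
Context (K : vectType R) (dotK : {dot K for idfun}).
Context (w : E -> R) (T : forall e, 'Hom(H (src e), H (tgt e))).
Context (A : {linear dsum H -> K}).

Local Notation edge_space := (dsum (fun e => H (tgt e))).
Local Notation obs_space := (edge_space * K)%type.

Definition edge_op (z : dsum H) : edge_space :=
  [ffun e => Num.sqrt (w e) *: (z (tgt e) - T e (z (src e)))].

Definition obs_op (h : dsum H) : obs_space := (edge_op h, A h).

Definition obs_norm (y : obs_space) : R :=
  Num.sqrt (dsum_norm (fun e => dotH (tgt e)) y.1 ^+ 2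
            + dot_norm dotK y.2 ^+ 2).

(* When the total space is nonzero and [0 < k] the set is nonempty, and the
   infimum is attained because each of the finitely many coordinate subspaces
   involved is finite-dimensional. *)
Definition margin (k : nat) : R :=
  inf [set obs_norm (obs_op h) / dsum_norm dotH h | h in
        [set h : dsum H | h != 0 /\ (group_sparsity h <= 2 * k)%N]].

End Observation.

Section Risk.
Context (R : realType) (X Y : lmodType R) (normX : X -> R) (normY : Y -> R).

Definition norm_open (U : set X) : Prop :=
  forall x, U x ->
    exists2 r : R, 0 < r & forall x', normX (x' - x) < r -> U x'.

(* A randomized estimator draws its internal randomness from an arbitrary
   probability space; for each observation its output is a Borel random element
   of X.  No regularity in the observation is required. *)
Inductive estimator : Type :=
| Deterministic of (Y -> X)
| Randomized (d : measure_display) (Omega : measurableType d)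
    (P : probability Omega R) (f : Y -> Omega -> X)
    of (forall y (U : set X), norm_open U -> measurable (f y @^-1` U)).

Definition expected_loss (est : estimator) (y : Y) (e : X) : \bar R :=
  match est with
  | Deterministic f => (normX (f y - e))%:E
  | @Randomized d Omega P f _ => 'E_P[fun omega => normX (f y omega - e)]
  end.

Definition worst_case_risk (B : X -> Y) (S : set X) (eps : R)
    (est : estimator) : \bar R :=
  ereal_sup [set expected_loss est (B e + xi) e | e in S
               & xi in [set xi : Y | normY xi <= eps]].

Definition minimax_risk (B : X -> Y) (S : set X) (eps : R) : \bar R :=
  ereal_inf [set rho | exists est : estimator, rho = worst_case_risk B S eps est].

End Risk.

Section Classes.
Context (R : realType) (I : finType) (H : I -> vectType R).
Context (dotH : forall i, {dot H i for idfun}).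

Definition sparse_class (k : nat) : set (dsum H) :=
  [set e | (group_sparsity e <= k)%N].

Definition sparse_ball (k : nat) (r : R) : set (dsum H) :=
  [set e | (group_sparsity e <= k)%N /\ dsum_norm dotH e <= r].

End Classes.

(* Also +oo when both eps and gamma vanish. *)
Definition noise_over_margin (R : realType) (eps gamma : R) : \bar R :=
  if gamma == 0 then +oo%E else (2 * eps / gamma)%:E.

(* Main.v *)
(** Lower bound: a 2k-sparse [h] is a difference [e1 - e2] of two k-sparse
    vectors with disjoint supports and norms at most [|h|].  If [|B h| <= 2 eps],
    the midpoint of [B e1] and [B e2] is an admissible observation of both, so
    every estimator errs by at least [|h| / 2] on one of them; let [|B h| / |h|]
    approach the margin.  Upper bound: two elements of the class that are
    consistent with the same observation differ by a 2k-sparse [h] with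
    [|B h| <= 2 eps].  Only for margin 0 does it matter that the infimum is
    attained. *)
From HB Require Import structures.
Require Import Defs.
From mathcomp Require Import all_boot all_order all_algebra.
From mathcomp Require Import all_classical all_reals all_analysis.
From mathcomp Require Import measurable_realfun ring lra.
Set Implicit Arguments.
Unset Strict Implicit.
Unset Printing Implicit Defensive.
Import Order.TTheory GRing.Theory Num.Theory.
Local Open Scope classical_set_scope.
Local Open Scope ring_scope.

(** * Norms of real inner products: Cauchy-Schwarz and coefficient bounds *)

Section InnerProduct.
Context (R : realType) (V : lmodType R) (f : {dot V for idfun}).
Implicit Types (u v : V) (a : R).

(** The formula of [dot_norm], over any [lmodType], so that it also serves direct sums and
    products. *)
Definition inner_norm v : R := Num.sqrt (f v v).

Lemma innerC u v : f u v = f v u.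
Proof. by rewrite hermC expr0 mul1r. Qed.

Lemma inner_ge0 v : 0 <= f v v.
Proof.
have [->|v_neq0] := eqVneq v 0; first by rewrite linear0r.
exact/ltW/neq0_dnorm_gt0.
Qed.

Lemma innerZl a u v : f (a *: u) v = a * f u v.
Proof. by rewrite linearZl_LR. Qed.

Lemma innerZr a u v : f u (a *: v) = a * f u v.
Proof. by rewrite innerC innerZl innerC. Qed.

Lemma inner_norm_ge0 v : 0 <= inner_norm v.
Proof. exact: sqrtr_ge0. Qed.

Lemma sqr_inner_norm v : inner_norm v ^+ 2 = f v v.
Proof. by rewrite sqr_sqrtr ?inner_ge0. Qed.

Lemma inner_norm0 : inner_norm 0 = 0.
Proof. by rewrite /inner_norm linear0r sqrtr0. Qed.

Lemma inner_norm_eq0 v : (inner_norm v == 0) = (v == 0).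
Proof.
apply/idP/eqP => [|->]; last by rewrite inner_norm0.
apply: contraTeq => v_neq0; rewrite gt_eqF // sqrtr_gt0.
exact: neq0_dnorm_gt0.
Qed.

Lemma inner_norm_gt0 v : (0 < inner_norm v) = (v != 0).
Proof. by rewrite lt_def inner_norm_ge0 andbT inner_norm_eq0. Qed.

Lemma inner_normZ a v : inner_norm (a *: v) = `|a| * inner_norm v.
Proof.
by rewrite /inner_norm innerZl innerZr mulrA sqrtrM ?sqr_ge0 // -expr2 sqrtr_sqr.
Qed.

Lemma inner_normN v : inner_norm (- v) = inner_norm v.
Proof. by rewrite -scaleN1r inner_normZ normrN1 mul1r. Qed.

Lemma inner_CauchySchwarz u v : `|f u v| <= inner_norm u * inner_norm v.
Proof.
have [->|v_neq0] := eqVneq v 0.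
  by rewrite linear0r normr0 mulr_ge0 ?inner_norm_ge0.
have fv_gt0 : 0 < f v v by apply: neq0_dnorm_gt0.
rewrite -(@ler_pXn2r _ 2) ?nnegrE ?mulr_ge0 ?inner_norm_ge0 //.
rewrite exprMn !sqr_inner_norm real_normK ?num_real //.
(* This vector is [f v v] times the component of [u] orthogonal to [v]; its square is [f v v] times
   the Cauchy-Schwarz defect. *)
have := inner_ge0 (f v v *: u - f u v *: v).
rewrite linearBl !linearBr /= !(innerZl, innerZr) (innerC v u).
have -> : f v v * (f v v * f u u) - f v v * (f u v * f u v)
   - (f u v * (f v v * f u v) - f u v * (f u v * f v v))
   = f v v * (f u u * f v v - f u v ^+ 2) by ring.
by rewrite pmulr_rge0 // subr_ge0.
Qed.

Lemma inner_normD u v : inner_norm (u + v) <= inner_norm u + inner_norm v.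
Proof.
rewrite -(@ler_pXn2r _ 2) ?nnegrE ?addr_ge0 ?inner_norm_ge0 //.
rewrite sqr_inner_norm sqrrD !sqr_inner_norm linearDl !linearDr /=.
rewrite (innerC v u).
have := le_trans (ler_norm _) (inner_CauchySchwarz u v); lra.
Qed.

Lemma inner_norm_sum (J : finType) (g : J -> V) :
  inner_norm (\sum_j g j) <= \sum_j inner_norm (g j).
Proof.
elim/big_ind2: _ => [|x u y v ux vy|//]; first by rewrite inner_norm0.
exact: (le_trans (inner_normD _ _) (lerD _ _)).
Qed.

(* The Gram matrix of a free family is invertible, so the coefficients of a
   combination are linear functions of its inner products with the family,
   and those are bounded by Cauchy-Schwarz. *)
Lemma coef_bound (m : nat) (e : 'I_m -> V) :
  (forall a : 'I_m -> R, \sum_i a i *: e i = 0 -> forall i, a i = 0) ->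
  exists2 C : R, 0 <= C &
    forall (a : 'I_m -> R) i, `|a i| <= C * inner_norm (\sum_j a j *: e j).
Proof.
move=> free_e; pose G : 'M[R]_m := \matrix_(i, j) f (e i) (e j).
have mulG (a : 'rV[R]_m) j : (a *m G) ord0 j = f (\sum_i a ord0 i *: e i) (e j).
  by rewrite mxE linear_sumlz; apply: eq_bigr => i _; rewrite mxE linearZl_LR.
have Gunit : G \in unitmx.
  rewrite -row_free_unit; apply: inj_row_free => a aG0.
  set h := \sum_i a ord0 i *: e i.
  have h0 : h = 0.
    (* By [aG0], [h] is orthogonal to every [e j], hence to itself. *)
    apply/eqP; rewrite -inner_norm_eq0 /inner_norm {2}/h linear_sumr.
    rewrite big1 ?sqrtr0 // => j _.
    by rewrite linearZr_LR /= -mulG aG0 mxE mulr0.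
  by apply/rowP => i; rewrite mxE (free_e (a ord0)).
(* The inner sum bounds the coefficient of index [i]; summing over [i] gives one constant for all of
   them. *)
exists (\sum_i \sum_j inner_norm (e j) * `|invmx G j i|).
  apply: sumr_ge0 => i _; apply: sumr_ge0 => j _.
  by rewrite mulr_ge0 ?inner_norm_ge0.
move=> a i; set h := \sum_j a j *: e j.
pose b : 'rV[R]_m := \row_j a j.
have bG j : (b *m G) ord0 j = f h (e j).
  by rewrite mulG; under eq_bigr do rewrite mxE.
have -> : a i = \sum_j f h (e j) * invmx G j i.
  transitivity (b ord0 i); first by rewrite mxE.
  by rewrite -[b](mulmxK Gunit) mxE; under eq_bigr do rewrite bG.
apply: (le_trans (ler_norm_sum _ _ _)).
rewrite [X in _ <= X * _](bigD1 i) //= mulrDl ler_wpDr //.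
  rewrite mulr_ge0 ?inner_norm_ge0 // sumr_ge0 // => l _.
  by apply: sumr_ge0 => j _; rewrite mulr_ge0 ?inner_norm_ge0.
rewrite mulr_suml; apply: ler_sum => j _; rewrite normrM mulrAC.
by rewrite ler_wpM2r // mulrC inner_CauchySchwarz.
Qed.

End InnerProduct.

(** * The inner product of a direct sum *)

Section DirectSumInner.
Context (R : realType) (I : finType) (H : I -> vectType R).
Context (dotH : forall i, {dot H i for idfun}).

Definition dsum_dot (f g : dsum H) : R := \sum_i dotH i (f i) (g i).

Lemma dsum_dot_linear_l (g : dsum H) : scalar (dsum_dot^~ g).
Proof.
move=> a u v; rewrite /dsum_dot mulr_sumr -big_split /=.
by apply: eq_bigr => i _; rewrite !ffunE linearPl.
Qed.

Lemma dsum_dotC (f g : dsum H) : dsum_dot f g = dsum_dot g f.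
Proof. by apply: eq_bigr => i _; rewrite innerC. Qed.

Fact dsum_dot_bilinear :
  bilinear_for *%R (idfun \; *%R) (dsum_dot : dsum H -> dsum H -> R).
Proof.
split=> u; first exact: dsum_dot_linear_l.
by move=> a x y /=; rewrite !(dsum_dotC u) dsum_dot_linear_l.
Qed.
HB.instance Definition _ := bilinear_isBilinear.Build R (dsum H) (dsum H) R
  *%R (idfun \; *%R) dsum_dot dsum_dot_bilinear.

Fact dsum_dot_hermitian (f g : dsum H) :
  dsum_dot f g = (-1) ^+ false * idfun (dsum_dot g f).
Proof. by rewrite expr0 mul1r dsum_dotC. Qed.
HB.instance Definition _ := isHermitianSesquilinear.Build R (dsum H) false idfun
  dsum_dot dsum_dot_hermitian.

Fact dsum_dot_gt0 (f : dsum H) : f != 0 -> 0 < dsum_dot f f.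
Proof.
have f_ge0 i : true -> 0 <= dotH i (f i) (f i) by move=> _; exact: inner_ge0.
move=> f_neq0; rewrite lt_def sumr_ge0 // andbT.
apply: contra_neq f_neq0 => /eqP; rewrite psumr_eq0 // => /allP f0.
apply/ffunP => i; rewrite ffunE; apply/eqP.
apply: contraTT (f0 i (mem_index_enum i)) => fi.
by rewrite gt_eqF // neq0_dnorm_gt0.
Qed.
HB.instance Definition _ := isDotProduct.Build R (dsum H) dsum_dot dsum_dot_gt0.


(** An equality of functions, because [estimator] and [minimax_risk] take the norm itself as a
    parameter. *)
Lemma dsum_normE : dsum_norm dotH = inner_norm dsum_dot.
Proof.
apply/funext => h; congr Num.sqrt; apply: eq_bigr => i _.
exact: sqr_inner_norm.
Qed.

End DirectSumInner.

(** * The inner product of a product of two spaces *)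

Section ProductInner.
Context (R : realType) (U V : lmodType R).
Context (dotU : {dot U for idfun}) (dotV : {dot V for idfun}).

Definition prod_dot (x y : U * V) : R := dotU x.1 y.1 + dotV x.2 y.2.

Lemma prod_dot_linear_l (y : U * V) : scalar (prod_dot^~ y).
Proof. by move=> a u v; rewrite /prod_dot /= !linearPl /=; ring. Qed.

Lemma prod_dotC (x y : U * V) : prod_dot x y = prod_dot y x.
Proof. by rewrite /prod_dot innerC (innerC dotV). Qed.

Fact prod_dot_bilinear :
  bilinear_for *%R (idfun \; *%R) (prod_dot : (U * V)%type -> (U * V)%type -> R).
Proof.
split=> u; first exact: prod_dot_linear_l.
by move=> a x y /=; rewrite !(prod_dotC u) prod_dot_linear_l.
Qed.
HB.instance Definition _ :=
  bilinear_isBilinear.Build R (U * V)%type (U * V)%type R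
    *%R (idfun \; *%R) prod_dot prod_dot_bilinear.

Fact prod_dot_hermitian (x y : U * V) :
  prod_dot x y = (-1) ^+ false * idfun (prod_dot y x).
Proof. by rewrite expr0 mul1r prod_dotC. Qed.
HB.instance Definition _ :=
  isHermitianSesquilinear.Build R (U * V)%type false idfun
    prod_dot prod_dot_hermitian.

Fact prod_dot_gt0 (x : U * V) : x != 0 -> 0 < prod_dot x x.
Proof.
case: x => x y; rewrite -pair_eqE negb_and /prod_dot /= => /orP[?|?].
  by rewrite ltr_wpDr ?inner_ge0 // neq0_dnorm_gt0.
by rewrite ltr_wpDl ?inner_ge0 // neq0_dnorm_gt0.
Qed.
HB.instance Definition _ :=
  isDotProduct.Build R (U * V)%type prod_dot prod_dot_gt0.

End ProductInner.

(** * Two-point lower bound on the worst-case risk *)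

Section TwoPoints.
Context (R : realType) (X Y : lmodType R).
Context (dotX : {dot X for idfun}) (dotY : {dot Y for idfun}).
Local Notation normX := (inner_norm dotX).
Local Notation normY := (inner_norm dotY).

(** Rays unbounded below generate the Borel sets; their preimages are those of balls around [e],
    which are open by the triangle inequality. *)
Lemma measurable_dist d (Omega : measurableType d) (g : Omega -> X) (e : X) :
  (forall U, norm_open normX U -> measurable (g @^-1` U)) ->
  measurable_fun setT (fun omega => normX (g omega - e)).
Proof.
move=> mg; apply: (measurability _ (RGenInftyO.measurableE R)).
move=> _ [_ [c ->] <-]; rewrite setTI.
have /mg : norm_open normX [set x | normX (x - e) < c].
  move=> x /= xc; exists (c - normX (x - e)); first by rewrite subr_gt0.
  move=> x' x'x; have -> : x' - e = (x' - x) + (x - e) by rewrite addrA subrK.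
  by apply: (le_lt_trans (inner_normD _ _ _)); rewrite -ltrBrDr.
by congr measurable; apply/seteqP; split => omega /=; rewrite in_itv.
Qed.

(** Both losses are taken at the same [y], hence with the same randomness: the triangle inequality
    holds at each outcome and survives integration. *)
Lemma expected_loss_dist (est : estimator Y normX) (y : Y) (e1 e2 : X) :
  ((normX (e1 - e2))%:E <= expected_loss est y e1 + expected_loss est y e2)%E.
Proof.
have tri x : normX (e1 - e2) <= normX (x - e1) + normX (x - e2).
  have -> : e1 - e2 = - (x - e1) + (x - e2) by rewrite opprB addrA subrK.
  by rewrite (le_trans (inner_normD _ _ _)) // inner_normN.
case: est => [g|d Omega P g mg] /=; first by rewrite -EFinD lee_fin tri.
have mdist e := measurable_dist e (mg y).
rewrite -[leLHS](expectation_cst P) unlock -ge0_integralD //=; first last.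
- exact/measurable_EFinP/mdist.
- by move=> x _; rewrite lee_fin inner_norm_ge0.
- exact/measurable_EFinP/mdist.
- by move=> x _; rewrite lee_fin inner_norm_ge0.
apply: ge0_le_integral => //=.
- by move=> x _; rewrite lee_fin inner_norm_ge0.
- by apply: emeasurable_funD; exact/measurable_EFinP/mdist.
- by move=> x _; rewrite -EFinD lee_fin tri.
Qed.

Lemma worst_case_risk_two_points (B : {linear X -> Y}) (S : set X) (eps : R)
    (est : estimator Y normX) (e1 e2 : X) :
  S e1 -> S e2 -> normY (B (e1 - e2)) <= 2 * eps ->
  ((2^-1 * normX (e1 - e2))%:E <= worst_case_risk normY B S eps est)%E.
Proof.
move=> Se1 Se2 Beps; set rho := worst_case_risk _ _ _ _ _.
pose y := 2^-1 *: (B e1 + B e2).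
have halfB (x : Y) : normY (2^-1 *: x) = 2^-1 * normY x.
  by rewrite inner_normZ ger0_norm // invr_ge0.
have le_rho e xi : S e -> normY xi <= eps -> B e + xi = y ->
    (expected_loss est y e <= rho)%E.
  by move=> Se xi_eps <-; apply: ereal_sup_ubound; exists e => //; exists xi.
have half_sum (a b : Y) : 2^-1 *: (a + b) = a - 2^-1 *: (a - b).
  have {2}-> : a = 2^-1 *: a + 2^-1 *: a.
    by rewrite -scalerDl (_ : 2^-1 + 2^-1 = 1) ?scale1r //; lra.
  by rewrite scalerDr scalerBr opprB addrACA subrr addr0.
have le1 : (expected_loss est y e1 <= rho)%E.
  apply: (@le_rho _ (- (2^-1 *: B (e1 - e2)))) => //.
    by rewrite inner_normN halfB; lra.
  by rewrite /y half_sum linearB.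
have le2 : (expected_loss est y e2 <= rho)%E.
  apply: (@le_rho _ (2^-1 *: B (e1 - e2))) => //; first by rewrite halfB; lra.
  rewrite /y (addrC (B e1)) half_sum linearB; congr (_ + _).
  by rewrite -scalerN opprB.
have := le_trans (expected_loss_dist est y e1 e2) (leeD le1 le2).
(* Halving is real arithmetic; [+oo] bounds everything, and [-oo] cannot bound a real number. *)
case: rho {le_rho le1 le2} => [rho| |].
- by rewrite -EFinD !lee_fin; lra.
- by rewrite addye // !leey.
- by rewrite addeNy !leeNy_eq.
Qed.

End TwoPoints.

(** * Supports, coordinates, and operators injective on a coordinate subspace *)

Section Support.
Context (R : realType) (I : finType) (H : I -> vectType R).
Implicit Types (S : {set I}) (h : dsum H).

Lemma dsum_sumE (J : Type) (s : seq J) (P : pred J) (g : J -> dsum H) i :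
  (\sum_(j <- s | P j) g j) i = \sum_(j <- s | P j) g j i.
Proof. by elim/big_rec2: _ => [|j x y _ <-]; rewrite ffunE. Qed.

Definition dsum_restrict S h : dsum H := [ffun i => if i \in S then h i else 0].

Lemma dsum_restrictD_compl S h :
  dsum_restrict S h + dsum_restrict (~: S)%SET h = h.
Proof.
apply/ffunP => i; rewrite !ffunE finset.in_setC.
by case: (i \in S); rewrite ?addr0 ?add0r.
Qed.

Lemma group_sparsity_le S h : (forall i, h i != 0 -> i \in S) ->
  (group_sparsity h <= #|S|)%N.
Proof.
by move=> hS; apply/subset_leq_card/fintype.subsetP => i; rewrite inE => /hS.
Qed.

Lemma group_sparsityB h1 h2 :
  (group_sparsity (h1 - h2)%R <= group_sparsity h1 + group_sparsity h2)%N.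
Proof.
apply: leq_trans (leq_card_setU _ _); apply: group_sparsity_le => i.
rewrite !inE !ffunE -negb_and; apply: contra => /andP[/eqP-> /eqP->].
by rewrite subr0.
Qed.

Lemma group_sparsityZ (a : R) h : (group_sparsity (a *: h) <= group_sparsity h)%N.
Proof.
apply: group_sparsity_le => i; rewrite inE !ffunE.
by apply: contra => /eqP->; rewrite scaler0.
Qed.

Lemma group_sparsity0 : group_sparsity (0 : dsum H) = 0%N.
Proof. by apply: eq_card0 => i; rewrite !inE !ffunE eqxx. Qed.

Context (dotH : forall i, {dot H i for idfun}).

Lemma inner_norm_restrict S h :
  inner_norm (dsum_dot dotH) (dsum_restrict S h) <= inner_norm (dsum_dot dotH) h.
Proof.
rewrite ler_wsqrtr //; apply: ler_sum => i _; rewrite ffunE.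
by case: ifP => // _; rewrite linear0r inner_ge0.
Qed.

(** The list of nonzero coordinates is cut after its first [k] entries; restricting to either piece
    only drops nonnegative terms from the squared norm. *)
Lemma sparse_split (k : nat) h : (group_sparsity h <= 2 * k)%N ->
  exists e1 e2, [/\ e1 - e2 = h,
    (group_sparsity e1 <= k)%N, (group_sparsity e2 <= k)%N,
    inner_norm (dsum_dot dotH) e1 <= inner_norm (dsum_dot dotH) h &
    inner_norm (dsum_dot dotH) e2 <= inner_norm (dsum_dot dotH) h].
Proof.
set s := enum [set i | h i != 0]%SET => h2k.
have s_size : size s = group_sparsity h by rewrite /group_sparsity cardE.
pose S := [set i in take k s]%SET.
have cardS (s' : seq I) : (#|[set i in s']%SET| <= size s')%N.
  by rewrite cardsE card_size.
exists (dsum_restrict S h), (- dsum_restrict (~: S)%SET h); split.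
- by rewrite opprK dsum_restrictD_compl.
- apply: (@leq_trans #|S|).
    by apply: group_sparsity_le => i; rewrite ffunE; case: ifP; rewrite ?eqxx.
  by rewrite (leq_trans (cardS _)) // size_take_min geq_minl.
- apply: (@leq_trans #|[set i in drop k s]%SET|); last first.
    by rewrite (leq_trans (cardS _)) // size_drop s_size leq_subLR addnn -mul2n.
  apply: group_sparsity_le => i; rewrite !ffunE !inE.
  case: ifP; rewrite ?oppr0 ?eqxx // oppr_eq0 => iS hi.
  have : i \in take k s ++ drop k s by rewrite cat_take_drop mem_enum inE.
  by rewrite mem_cat (negbTE iS).
- exact: inner_norm_restrict.
- by rewrite inner_normN inner_norm_restrict.
Qed.

Definition basis_index := {i : I & 'I_(\dim {:H i})}.

(** [dfwith] overwrites one slot of the zero family and handles the type equality between [H j] and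
    [H (tag x)]. *)
Definition basis_vec (x : basis_index) : dsum H :=
  [ffun j =>
     dfwith (fun j => 0 : H j) (tag x) (vbasis {:H (tag x)})`_(tagged x) j].

Definition basis_coord (x : basis_index) h : R :=
  coord (vbasis {:H (tag x)}) (tagged x) (h (tag x)).

Lemma basis_coord_vec x y : basis_coord x (basis_vec y) = (x == y)%:R.
Proof.
rewrite /basis_coord ffunE; case: x y => i p [j q] /=.
have [ij|j_neq_i] := eqVneq j i.
  subst j; rewrite dfwithin coord_free ?(basis_free (vbasisP _)) //.
  by rewrite eq_Tagged /= eq_sym.
by rewrite dfwithout // linear0 -tag_eqE /tag_eq /= eq_sym (negbTE j_neq_i).
Qed.

Lemma basis_expansion h : h = \sum_x basis_coord x h *: basis_vec x.
Proof.
apply/ffunP => i; rewrite dsum_sumE.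
(* The sum over dependent pairs becomes a double sum over nodes and basis positions; only node [i]
   contributes to slot [i]. *)
rewrite -(@sig_big_dep _ _ _ _ _ xpredT (fun _ => xpredT)
  (fun j p => let x : basis_index := Tagged (fun j => 'I_(\dim {:H j})) p in
     (basis_coord x h *: basis_vec x) i)) /=.
rewrite (bigD1 i) //= [X in _ + X]big1 => [|j j_neq_i]; last first.
  by apply: big1 => p _; rewrite !ffunE dfwithout ?scaler0.
rewrite addr0 [LHS](coord_vbasis (memvf _)); apply: eq_bigr => p _.
by rewrite !ffunE /= dfwithin.
Qed.

Lemma basis_expansion_support S h : (forall i, h i != 0 -> i \in S) ->
  h = \sum_(x | tag x \in S) basis_coord x h *: basis_vec x.
Proof.
move=> hS; rewrite [LHS]basis_expansion [LHS](bigID (fun x => tag x \in S)) /=.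
rewrite [X in _ + X]big1 ?addr0 // => x xS; rewrite /basis_coord.
suff -> : h (tag x) = 0 by rewrite linear0 scale0r.
by apply/eqP; apply: contraNT xS => /hS.
Qed.

(** Injectivity makes the images of the basis vectors located in [S] a free family, so [coef_bound],
    applied in [Y], controls the coordinates of [h] by the norm of [B h]. *)
Lemma bounded_below_on_support (Y : lmodType R) (dotY : {dot Y for idfun})
    (B : {linear dsum H -> Y}) S :
  (forall h, (forall i, h i != 0 -> i \in S) -> B h = 0 -> h = 0) ->
  exists2 C : R, 0 <= C & forall h, (forall i, h i != 0 -> i \in S) ->
    inner_norm (dsum_dot dotH) h <= C * inner_norm dotY (B h).
Proof.
move=> injB; pose P : pred basis_index := fun x => tag x \in S.
pose u (j : 'I_#|P|) := basis_vec (enum_val j).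
have [|C C_ge0 coefC] := @coef_bound R Y dotY #|P| (B \o u).
  move=> a aBu0 j; set g := \sum_j a j *: u j.
  have g0 : g = 0.
    apply: injB => [i|]; last first.
      by rewrite linear_sum -[RHS]aBu0; apply: eq_bigr => l _; rewrite linearZ.
    apply: contraNT => iS; rewrite dsum_sumE big1 // => l _.
    rewrite !ffunE dfwithout ?scaler0 //.
    by apply: contraNneq iS => <-; exact: (enum_valP l).
  (* Reading this coordinate of [g] isolates [a j]. *)
  have : basis_coord (enum_val j) g = 0 by rewrite g0 /basis_coord ffunE linear0.
  rewrite /basis_coord dsum_sumE linear_sum (bigD1 j) //= big1 => [|l lj].
    rewrite ffunE linearZ /= -/(basis_coord _ _) basis_coord_vec eqxx.
    by rewrite mulr1 addr0.
  rewrite ffunE linearZ /= -/(basis_coord _ _) basis_coord_vec.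
  by rewrite (inj_eq enum_val_inj) eq_sym (negbTE lj) mulr0.
exists (\sum_j C * inner_norm (dsum_dot dotH) (u j)).
  by apply: sumr_ge0 => j _; rewrite mulr_ge0 ?inner_norm_ge0.
move=> h hS; pose a (j : 'I_#|P|) := basis_coord (enum_val j) h.
have hE : h = \sum_j a j *: u j.
  by rewrite [LHS](basis_expansion_support hS) big_enum_val.
have BhE : B h = \sum_j a j *: (B \o u) j.
  by rewrite {1}hE linear_sum; apply: eq_bigr => j _; rewrite linearZ.
rewrite {1}hE (le_trans (inner_norm_sum _ _)) // mulr_suml.
apply: ler_sum => j _; rewrite inner_normZ mulrAC ler_wpM2r ?inner_norm_ge0 //.
by rewrite BhE coefC.
Qed.

End Support.

(** * The margin of a linear operator and the risk bounds *)

Section SparseMargin.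
Context (R : realType) (I : finType) (H : I -> vectType R) (Y : lmodType R).
Context (dotH : forall i, {dot H i for idfun}) (dotY : {dot Y for idfun}).
Context (B : {linear dsum H -> Y}) (k : nat).
Hypotheses (H_neq0 : exists h : dsum H, h != 0) (k_gt0 : (0 < k)%N).
Local Notation normX := (inner_norm (dsum_dot dotH)).
Local Notation normY := (inner_norm dotY).
Implicit Types h : dsum H.

(** The set whose infimum is [margin], for an abstract linear [B]. *)
Definition sparse_ratios : set R :=
  [set normY (B h) / normX h | h in
     [set h | h != 0 /\ (group_sparsity h <= 2 * k)%N]].
Local Notation gamma := (inf sparse_ratios).

Lemma sparse_ratios_ge0 : lbound sparse_ratios 0.
Proof. by move=> _ [h _ <-]; rewrite divr_ge0 ?inner_norm_ge0. Qed.

(** Keeps [inf] away from its default value: one nonzero coordinate of a nonzero vector gives an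
    admissible vector, since [0 < k]. *)
Lemma sparse_ratios_neq0 : sparse_ratios !=set0.
Proof.
have [h h_neq0] := H_neq0; have [i hi] : exists i, h i != 0.
  apply/existsP; apply: contraNT h_neq0; rewrite negb_exists => /forallP h0.
  by apply/eqP/ffunP => i; rewrite ffunE; apply/eqP; rewrite -[_ == _]negbK h0.
pose h' := dsum_restrict [set i]%SET h.
exists (normY (B h') / normX h'); exists h' => //; split.
  apply: contra_neq hi => /ffunP/(_ i).
  by rewrite !ffunE finset.in_set1 eqxx.
apply: (@leq_trans #|[set i]%SET|); last by rewrite cards1 muln_gt0.
by apply: group_sparsity_le => j; rewrite ffunE; case: ifP; rewrite ?eqxx.
Qed.

Lemma margin_le h : (group_sparsity h <= 2 * k)%N ->
  gamma * normX h <= normY (B h).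
Proof.
have [->|h_neq0 h2k] := eqVneq h 0.
  by rewrite !inner_norm0 mulr0 inner_norm_ge0.
rewrite -ler_pdivlMr ?inner_norm_gt0 //.
apply: (ge_inf _ _); first by exists 0; exact: sparse_ratios_ge0.
by exists h.
Qed.

(** The ratio is invariant under scaling, so a nearly minimal vector can be given any prescribed
    norm. *)
Lemma sparse_at_norm (c s : R) : gamma < c -> 0 <= s ->
  exists h, [/\ (group_sparsity h <= 2 * k)%N, normX h = s & normY (B h) <= c * s].
Proof.
move=> /(inf_lt sparse_ratios_neq0) [_ [h [h_neq0 h2k] <-]] h_lt_c s_ge0.
have nh_gt0 : 0 < normX h by rewrite inner_norm_gt0.
have s_nh_ge0 : 0 <= s / normX h by rewrite divr_ge0 ?inner_norm_ge0.
exists ((s / normX h) *: h); split.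
- exact: leq_trans (group_sparsityZ _ _) h2k.
- by rewrite inner_normZ ger0_norm // divfK ?gt_eqF.
- rewrite linearZ inner_normZ ger0_norm // mulrAC -mulrA mulrC.
  by rewrite ler_wpM2r // ltW.
Qed.

(* Sparse vectors form a finite union of coordinate subspaces; if B is injective
   on each of them it is bounded below on each, hence on their union. *)
Lemma margin0_kernel : gamma = 0 ->
  exists h, [/\ h != 0, (group_sparsity h <= 2 * k)%N & B h = 0].
Proof.
move=> gamma0; apply: contrapT => no_kernel.
have inj h : (group_sparsity h <= 2 * k)%N -> B h = 0 -> h = 0.
  move=> h2k Bh0; apply/eqP; apply: contra_notT no_kernel => h_neq0.
  by exists h.
(* The cardinality condition sits inside the existential so that [choice] yields a constant for
   every [S]; large sets get the dummy value 0. *)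
have bound (S : {set I}) : exists C : R, (0 <= C) /\ ((#|S| <= 2 * k)%N ->
    forall h, (forall i, h i != 0 -> i \in S) -> normX h <= C * normY (B h)).
  have [S2k|] := leqP #|S| (2 * k); last by exists 0.
  have [|C C_ge0 boundC] := @bounded_below_on_support R I H dotH Y dotY B S.
    by move=> h hS; apply: inj; apply: leq_trans (group_sparsity_le hS) S2k.
  by exists C.
have [C boundC] := choice bound.
(* The sum dominates every [C S], and the [1] makes [D] positive, so [D^-1] is a positive lower
   bound for the ratios. *)
pose D := 1 + \sum_S C S.
have C_ge0 S : 0 <= C S by have [] := boundC S.
have D_gt0 : 0 < D by rewrite ltr_pwDl // sumr_ge0.
suff : D^-1 <= gamma by rewrite gamma0 leNgt invr_gt0 D_gt0.
apply: lb_le_inf => [|_ [h [h_neq0 h2k] <-]]; first exact: sparse_ratios_neq0.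
have nh_gt0 : 0 < normX h by rewrite inner_norm_gt0.
rewrite ler_pdivlMr // mulrC ler_pdivrMr // mulrC.
have [_ /(_ h2k h) hC] := boundC [set i | h i != 0]%SET.
apply: (le_trans (hC _)) => [i|]; first by rewrite inE.
rewrite ler_wpM2r ?inner_norm_ge0 // /D (bigD1 [set i | h i != 0]%SET) //= addrCA.
by rewrite lerDl addr_ge0 // sumr_ge0.
Qed.

(** Membership in [S] is asked relative to the norm of [h], which covers both the ball and the class
    without norm bound. *)
Lemma worst_case_risk_ge (S : set (dsum H)) (eps : R)
    (est : estimator Y normX) h :
  (forall e, (group_sparsity e <= k)%N -> normX e <= normX h -> S e) ->
  (group_sparsity h <= 2 * k)%N -> normY (B h) <= 2 * eps ->
  ((2^-1 * normX h)%:E <= worst_case_risk normY B S eps est)%E.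
Proof.
move=> subS /(sparse_split dotH) [e1 [e2 [hE e1k e2k e1h e2h]]] Bh.
by rewrite -{1}hE; apply: worst_case_risk_two_points; rewrite ?hE //; apply: subS.
Qed.

Lemma worst_case_risk_zero (S : set (dsum H)) (eps r : R) :
  (forall e, S e -> normX e <= r) ->
  (worst_case_risk normY B S eps (Deterministic normX (fun=> 0%R)) <= r%:E)%E.
Proof.
move=> Sr; apply: ge_ereal_sup => _ [e Se [xi _ <-]] /=.
by rewrite lee_fin sub0r inner_normN Sr.
Qed.

Lemma worst_case_risk_consistent (S : set (dsum H)) (eps : R) :
  (forall e, S e -> (group_sparsity e <= k)%N) -> 0 < gamma ->
  (worst_case_risk normY B S eps
     (Deterministic normX
       (fun y => xget 0%R [set e | S e /\ (normY (y - B e) <= eps)%R]))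
   <= (2 * eps / gamma)%:E)%E.
Proof.
move=> Sk gamma_gt0; apply: ge_ereal_sup => _ [e Se [xi xi_eps <-]] /=.
(* The true vector is itself consistent, so [xget] does not fall back to its default [0]. *)
have : [set e' | S e' /\ normY (B e + xi - B e') <= eps] e.
  by split=> //; rewrite addrAC subrr add0r.
move=> /(xgetI 0); set e' := xget _ _ => -[Se' e'_eps].
rewrite lee_fin ler_pdivlMr // mulrC (le_trans (margin_le _)) //.
  by rewrite (leq_trans (group_sparsityB _ _)) // mul2n -addnn leq_add ?Sk.
(* The image of the error is a difference of two residuals, each of norm at most [eps]. *)
have -> : B (e' - e) = xi - (B e + xi - B e').
  by rewrite linearB opprB opprD addrCA (addrCA xi) subrr addr0.
rewrite (le_trans (inner_normD _ _ _)) // inner_normN.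
by move: xi_eps => /=; lra.
Qed.

Lemma minimax_risk_le (S : set (dsum H)) (eps r : R) :
  (forall e, S e -> (group_sparsity e <= k)%N /\ normX e <= r) ->
  (minimax_risk normX normY B S eps <= mine r%:E (noise_over_margin eps gamma))%E.
Proof.
move=> SP; rewrite le_min; apply/andP; split.
  apply: ge_ereal_inf.
  exists (worst_case_risk normY B S eps (Deterministic normX (fun=> 0%R))).
    by exists (Deterministic normX (fun=> 0%R)).
  by apply: worst_case_risk_zero => e /SP[].
rewrite /noise_over_margin; case: eqVneq => [_|gamma_neq0]; first exact: leey.
have gamma_gt0 : 0 < gamma.
  rewrite lt_def gamma_neq0; apply: lb_le_inf sparse_ratios_ge0.
  exact: sparse_ratios_neq0.
apply: ge_ereal_inf; eexists; last first.
  by apply: (@worst_case_risk_consistent S) => // e /SP[].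
by eexists.
Qed.

Lemma minimax_risk_ge (eps r : R) (S : set (dsum H)) :
  (forall e, (group_sparsity e <= k)%N -> normX e <= r -> S e) ->
  0 < r -> 0 <= eps ->
  ((2^-1)%:E * mine r%:E (noise_over_margin eps gamma)
     <= minimax_risk normX normY B S eps)%E.
Proof.
move=> subS r_gt0 eps_ge0; apply: le_ereal_inf_tmp => _ [est ->].
have risk_ge h : normX h <= r -> (group_sparsity h <= 2 * k)%N ->
    normY (B h) <= 2 * eps ->
    ((2^-1 * normX h)%:E <= worst_case_risk normY B S eps est)%E.
  move=> hr; apply: worst_case_risk_ge => e ek eh.
  by apply: subS => //; apply: le_trans hr.
rewrite /noise_over_margin; case: eqVneq => [gamma0|gamma_neq0].
  (* A kernel vector rescaled to norm [r] meets the noise constraint for every [eps >= 0], zero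
     included. *)
  have [h [h_neq0 h2k Bh0]] := margin0_kernel gamma0.
  rewrite min_l ?leey // -EFinM.
  have nh_gt0 : 0 < normX h by rewrite inner_norm_gt0.
  have nrh : normX ((r / normX h) *: h) = r.
    by rewrite inner_normZ ger0_norm ?divfK ?gt_eqF // divr_ge0 ?ltW.
  rewrite -{1}nrh; apply: risk_ge; first by rewrite nrh.
    exact: leq_trans (group_sparsityZ _ _) h2k.
  by rewrite linearZ /= Bh0 scaler0 inner_norm0 mulr_ge0.
have gamma_gt0 : 0 < gamma.
  rewrite lt_def gamma_neq0; apply: lb_le_inf sparse_ratios_ge0.
  exact: sparse_ratios_neq0.
rewrite -EFin_min -EFinM; set m := Num.min _ _; rewrite leNgt; apply/negP => lt_m.
(* Testing with [h = 0] excludes [-oo] and later makes [s] positive. *)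
have : (0 <= worst_case_risk normY B S eps est)%E.
  have := @risk_ge 0; rewrite linear0 !inner_norm0 mulr0; apply; first exact: ltW.
    by rewrite group_sparsity0.
  by rewrite mulr_ge0.
move: lt_m risk_ge; case: worst_case_risk => [rho| |] //.
rewrite lte_fin lee_fin => lt_m risk_ge rho_ge0.
(* The midpoint of [2 * rho] and [m]: a lower bound of [s / 2] on the risk contradicts
   [rho < s / 2]. *)
pose s := rho + 2^-1 * m; have s_gt0 : 0 < s by rewrite /s; lra.
have s_lt_m : s < m by rewrite /s; lra.
move: s_lt_m; rewrite {1}/m lt_min => /andP[s_lt_r s_lt_eps].
(* Since [s < 2 * eps / gamma] is strict, [gamma < 2 * eps / s], and it is enough to approach the
   infimum. *)
have [||h [h2k nh Bh]] := @sparse_at_norm (2 * eps / s) s.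
- by move: s_lt_eps; rewrite !ltr_pdivlMr // mulrC.
- exact: ltW.
have := risk_ge h; rewrite nh lee_fin => /(_ (ltW s_lt_r) h2k).
by rewrite divfK ?gt_eqF // in Bh => /(_ Bh); rewrite /s; lra.
Qed.

Lemma worst_case_risk_unbounded (eps : R) (est : estimator Y normX) :
  gamma = 0 -> 0 <= eps ->
  worst_case_risk normY B (sparse_class k) eps est = +oo%E.
Proof.
move=> /margin0_kernel[h [h_neq0 h2k Bh0]] eps_ge0.
have nh_gt0 : 0 < normX h by rewrite inner_norm_gt0.
apply/eqyP => c c_gt0.
(* The kernel vector is scaled to norm [2 * c], which offsets the factor one half. *)
have := @worst_case_risk_ge (sparse_class k) eps est ((2 * c / normX h) *: h).
rewrite inner_normZ ger0_norm ?divfK ?gt_eqF //; last first.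
  by rewrite divr_ge0 ?inner_norm_ge0 // mulr_ge0 // ltW.
rewrite mulKf //; apply=> //.
  exact: leq_trans (group_sparsityZ _ _) h2k.
by rewrite linearZ /= Bh0 scaler0 inner_norm0 mulr_ge0.
Qed.

End SparseMargin.

(** * Linearity and norm of the stacked operator; the theorem *)

Section ObservationOperator.
Context (R : realType) (n : nat) (E : finType) (src tgt : E -> 'I_n).
Context (H : 'I_n -> vectType R) (K : vectType R).
Context (w : E -> R) (T : forall e, 'Hom(H (src e), H (tgt e))).
Context (A : {linear dsum H -> K}).

Fact obs_op_linear : linear (obs_op w T A).
Proof.
move=> a x y; rewrite /obs_op linearP; congr pair; apply/ffunP => e.
rewrite !ffunE linearP /= scalerA [a * _]mulrC -scalerA -scalerDr.
by congr (_ *: _); rewrite scalerBr opprD addrACA.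
Qed.
HB.instance Definition _ :=
  GRing.isLinear.Build R (dsum H) (dsum (fun e => H (tgt e)) * K)%type *:%R
    (obs_op w T A) obs_op_linear.

Lemma obs_normE (dotH : forall i, {dot H i for idfun}) (dotK : {dot K for idfun}) :
  obs_norm (tgt := tgt) dotH dotK =
  inner_norm (prod_dot (dsum_dot (fun e => dotH (tgt e))) dotK).
Proof.
apply/funext => y; congr Num.sqrt.
by rewrite dsum_normE sqr_inner_norm /dot_norm sqr_sqrtr ?inner_ge0.
Qed.

End ObservationOperator.

Theorem theorem5 (R : realType) (n : nat) (E : finType) (src tgt : E -> 'I_n)
    (H : 'I_n -> vectType R) (dotH : forall i, {dot H i for idfun})
    (K : vectType R) (dotK : {dot K for idfun})
    (w : E -> R) (T : forall e, 'Hom(H (src e), H (tgt e)))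
    (A : {linear dsum H -> K}) (k : nat) (eps : R)
    (H_neq0 : exists h : dsum H, h != 0) (w_gt0 : forall e, 0 < w e)
    (k_ge1 : (1 <= k)%N) (eps_ge0 : 0 <= eps) :
  let B := obs_op w T A in
  let normX := dsum_norm dotH in
  let normY := obs_norm dotH dotK in
  let gamma := margin dotH dotK w T A k in
  (forall r : R, 0 < r ->
     let bound := mine r%:E (noise_over_margin eps gamma) in
     let risk := minimax_risk normX normY B (sparse_ball dotH k r) eps in
     ((2^-1)%:E * bound <= risk)%E /\ (risk <= bound)%E) /\
  (gamma = 0 ->
     forall est : estimator (dsum (fun e => H (tgt e)) * K)%type normX,
       worst_case_risk normY B (sparse_class k) eps est = +oo%E).
Proof.
rewrite /margin /sparse_ball dsum_normE obs_normE /=; split.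
  move=> r r_gt0; split; first exact: minimax_risk_ge.
  exact: minimax_risk_le.
by move=> gamma0 est; exact: worst_case_risk_unbounded.
Qed.
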